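(* Let $(X,\tau)$ be a Hausdorff topological space and let $S: X \rightrightarrows X$ be a set-valued map. Suppose $M:=\{x_i\}_{i=1}^{\infty}$ is an infinite f-t-contractive $S$-orbit and $S$ is lower semicontinuous on $M$. Then there exists a point $\bar{x} \in X$ such that $S(\bar{x}) \subseteq \{\bar{x}\}$.
   Context: A set-valued map $S:X\rightrightarrows X$ assigns to each $x\in X$ a (possibly empty) subset $S(x)\subseteq X$; $\operatorname{dom} S:=\{x\in X: S(x)\neq\emptyset\}$. An infinite $S$-orbit is a sequence $\{x_i\}_{i=1}^\infty$ in $X$ with $x_{i+1}\in S(x_i)$ for all $i\ge 1$ (repetitions, e.g. stationary sequences, are allowed). An infinite $S$-orbit $\{x_i\}_{i=1}^{\infty}$ is feebly topologically contractive (f-t-contractive) if for every open cover $\gamma$ of $X$ there exist $U\in\gamma$ and $i_0\in\mathbb{N}$ such that $x_{i_0}\in U$ and $S(x_{i_0})\subseteq U$. Writing $M$ also for the set of points of the orbit and $\operatorname{cl} M$ for its closure, $S$ is lower semicontinuous on $M$ at $x\in \operatorname{cl} M\cap\operatorname{dom} S$ if for every open $V\subseteq X$ with $S(x)\cap V\neq\emptyset$ there is an open neighborhood $U\subseteq X$ of $x$ such that $S(x')\cap V\neq\emptyset$ for all $x'\in U\cap M$; $S$ is lower semicontinuous on $M$ if this holds at every $x\in\operatorname{cl} M\cap\operatorname{dom} S$. *)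

(* Defs.v *)
From mathcomp Require Import all_boot all_classical.
From mathcomp Require Import topology.

Set Implicit Arguments.
Unset Strict Implicit.
Unset Printing Implicit Defensive.

Local Open Scope classical_set_scope.

(* A set-valued map from X to X is a function S : X -> set X; S x may be empty. *)

Definition svdom (X : Type) (S : X -> set X) : set X :=
  [set x | S x !=set0].

Definition infinite_orbit (X : Type) (S : X -> set X) (x : nat -> X) : Prop :=
  forall i : nat, S (x i) (x i.+1).

Definition open_cover (X : topologicalType) (gamma : set (set X)) : Prop :=
  gamma `<=` open /\ \bigcup_(U in gamma) U = [set: X].

Definition ft_contractive (X : topologicalType) (S : X -> set X)
    (x : nat -> X) : Prop :=
  forall gamma : set (set X), open_cover gamma ->
    exists U : set X, exists i0 : nat,
      [/\ gamma U, U (x i0) & S (x i0) `<=` U].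

(* x need not belong to M, and only the values of S at points of M near x
   are constrained. *)
Definition sv_lsc_on_at (X : topologicalType) (S : X -> set X) (M : set X)
    (x : X) : Prop :=
  forall V : set X, open V -> S x `&` V !=set0 ->
    exists2 U : set X, open_nbhs x U &
      forall x' : X, (U `&` M) x' -> S x' `&` V !=set0.

Definition sv_lsc_on (X : topologicalType) (S : X -> set X)
    (M : set X) : Prop :=
  forall x : X, (closure M `&` svdom S) x -> sv_lsc_on_at S M x.

(* Main.v *)
(* The open sets W such that no orbit point x_i in W has S(x_i) included in W
   cannot cover X, by contractivity.  A point outside their union is the desired
   one: if z had some y <> z in S(z), then z would be in cl M (otherwise take W to
   be the complement of cl M), and for disjoint open A around z and B around y,
   lower semicontinuity would make S(x_i) meet B for all orbit points near z,
   so a small neighborhood of z inside A would be such a W. *)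
Require Import Defs.
From mathcomp Require Import all_boot all_classical.
From mathcomp Require Import topology.

Local Open Scope classical_set_scope.

Theorem theorem2p5 (X : topologicalType) (hX : hausdorff_space X)
    (S : X -> set X) (x : nat -> X)
    (horb : infinite_orbit S x)
    (hft : ft_contractive S x)
    (hlsc : sv_lsc_on S (range x)) :
  exists xbar : X, S xbar `<=` [set xbar].
Proof.
pose gamma := [set W : set X | open W /\
  forall i, W (x i) -> ~ (S (x i) `<=` W)].
apply: contrapT => nofix.
have gammaE : \bigcup_(W in gamma) W = [set: X].
  rewrite -subTset => z _.
  have [y Szy /eqP nyz] : exists2 y, S z y & y <> z.
    apply: contrapT => nex; apply: nofix; exists z => y Szy.
    by apply: contrapT => nyz; apply: nex; exists y.
  have [Mz|nMz] := pselect (closure (range x) z); last first.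
    (* No orbit point lies in this set, so the second condition of [gamma] is vacuous. *)
    exists (~` closure (range x)) => //; split.
      exact/closed_openC/closed_closure.
    by move=> i nMxi; case: nMxi; apply: subset_closure; exists i.
  move: hX; rewrite open_hausdorff => /(_ _ _ nyz).
  move=> [[B A] /= [/set_mem By /set_mem Az] [oB oA AB0]].
  (* [y] witnesses both that [S z] is nonempty and that it meets [B]. *)
  have [] := hlsc z _ B oB; [by split=> //; exists y|by exists y|].
  move=> U [oU Uz] SB.
  (* For [x i] in [U], [S (x i)] meets [B], which is disjoint from [A], so it cannot lie inside
     [A]. *)
  exists (A `&` U); last by [].
  split; first exact: openI.
  move=> i [_ Uxi] SxiW.
  have [|w [Sw Bw]] := SB (x i); first by split=> //; exists i.
  have [Aw _] := SxiW _ Sw.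
  by have : (B `&` A) w by []; rewrite (eqP AB0).
(* Contractivity picks from the cover [gamma] a member violating its own defining condition. *)
have [|W [i [[_ Wno] Wxi SW]]] := hft gamma; first by split=> // W [].
exact: Wno Wxi SW.
Qed.
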